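(* Let $p\ge2$, consider the multiple regression function $f(x)=(1,x^T)^T$ on the rectangular design region $\mathcal{X}=[u_1,v_1]\times\cdots\times[u_{p-1},v_{p-1}]$ with $u_i<v_i$, and let $\beta=(\beta_0,\ldots,\beta_{p-1})^T$ with $\beta_i\neq0$ for $i=1,\ldots,p-1$. Let $d=(d_1,\ldots,d_{p-1})$ with $d_i=v_i$ if $\beta_i>0$ and $d_i=u_i$ if $\beta_i<0$. For $z>0$ let $$w_p^*(z)=\frac{2}{p+\sqrt{(p-2)^2+4(p-1)e^{z}}},\qquad w_1^*(z)=\cdots=w_{p-1}^*(z)=\frac{1-w_p^*(z)}{p-1}.$$ Then the equation $z(1-w_p^*(z))=2$ has a unique solution $z^*\in(0,\infty)$. If moreover $z^*\le\min_{i=1,\ldots,p-1}|\beta_i|(v_i-u_i)$, then the design $\xi^*$ assigning weight $w_1^*(z^* )$ to each point $d-(z^*/\beta_i)e_i$, $i=1,\ldots,p-1$, and weight $w_p^*(z^* )$ to $d$ is $D_s$-optimal for $\beta_1,\ldots,\beta_{p-1}$ in the Poisson model on $\mathcal{X}$.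
   Context: $e_i$ denotes the $i$-th standard unit vector of $\mathbb{R}^{p-1}$. A design $\xi$ is a probability measure on $\mathcal{X}$ with finite support $x_1,\ldots,x_l$ and weights $w_1,\ldots,w_l\ge0$, $\sum_jw_j=1$. The Poisson information matrix is $M_{Po}(\xi;\beta)=\sum_{j=1}^l w_j\exp(f(x_j)^T\beta)f(x_j)f(x_j)^T$. Let $A^T=(0_{p-1},I_{p-1})$ (a $(p-1)\times p$ matrix, $0_{p-1}$ the zero column). $A^T\beta$ is identifiable for $\xi$ if $A=M_{Po}(\xi;\beta)H$ for some $H\in\mathbb{R}^{p\times(p-1)}$. A design $\xi^*$ is $D_s$-optimal for $\beta_1,\ldots,\beta_{p-1}$ in the Poisson model if $A^T\beta$ is identifiable for $\xi^*$ and $\det(A^TM_{Po}(\xi^*;\beta)^-A)\le\det(A^TM_{Po}(\xi;\beta)^-A)$ for all designs $\xi$ on $\mathcal{X}$ for which $A^T\beta$ is identifiable, where $^-$ denotes a generalized inverse. *)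

(* Defs.v *)
From mathcomp Require Import all_boot all_order all_algebra.
From mathcomp Require Import reals.
From mathcomp Require Import sequences exp.
Set Implicit Arguments. Unset Strict Implicit. Unset Printing Implicit Defensive.
Import Order.TTheory GRing.Theory Num.Theory.
Local Open Scope ring_scope.

(* Regression function f(x) = (1, x^T)^T, with x in R^k, k = p-1. *)
Definition freg (R : realType) (k : nat) (x : 'cV[R]_k) : 'cV[R]_(1 + k) :=
  col_mx (const_mx 1) x.

(* A design with finite support: points X j with weights w j, j < l. *)
Definition info_mx (R : realType) (k l : nat) (X : 'I_l -> 'cV[R]_k)
  (w : 'I_l -> R) (beta : 'cV[R]_(1 + k)) : 'M[R]_(1 + k) :=
  \sum_(j < l) (w j * expR (((freg (X j))^T *m beta) 0 0))
                 *: (freg (X j) *m (freg (X j))^T).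

Definition Amx (R : realType) (k : nat) : 'M[R]_(1 + k, k) :=
  (row_mx (0 : 'M[R]_(k, 1)) (1%:M : 'M[R]_k))^T.

Definition is_design (R : realType) (k l : nat) (u v : 'cV[R]_k)
  (X : 'I_l -> 'cV[R]_k) (w : 'I_l -> R) : Prop :=
  [/\ forall j, 0 <= w j, \sum_(j < l) w j = 1 &
      forall j i, u i 0 <= X j i 0 <= v i 0].

Definition identifiable (R : realType) (k : nat) (M : 'M[R]_(1 + k)) : Prop :=
  exists H : 'M[R]_(1 + k, k), Amx R k = M *m H.

Definition ginv (R : realType) (n : nat) (M G : 'M[R]_n) : Prop :=
  M *m G *m M = M.

Definition Ds_optimal (R : realType) (k : nat) (u v : 'cV[R]_k)
  (beta : 'cV[R]_(1 + k)) (l : nat) (X : 'I_l -> 'cV[R]_k) (w : 'I_l -> R) : Prop :=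
  [/\ is_design u v X w,
      identifiable (info_mx X w beta) &
      forall (l' : nat) (X' : 'I_l' -> 'cV[R]_k) (w' : 'I_l' -> R),
        is_design u v X' w' -> identifiable (info_mx X' w' beta) ->
        forall G G' : 'M[R]_(1 + k),
          ginv (info_mx X w beta) G -> ginv (info_mx X' w' beta) G' ->
          \det ((Amx R k)^T *m G *m Amx R k) <= \det ((Amx R k)^T *m G' *m Amx R k)].

(* Main.v *)
Require Import Defs.
From mathcomp Require Import all_boot all_order all_algebra.
From mathcomp Require Import reals.
From mathcomp Require Import sequences exp.
From mathcomp Require Import classical_sets functions topology tvs normedtype.
From mathcomp Require Import derive realfun.
From mathcomp Require Import ring lra.
Import Order.TTheory GRing.Theory Num.Theory.
Import numFieldNormedType.Exports.
Local Open Scope classical_set_scope.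
Local Open Scope ring_scope.

(* For the information matrix M of a design, identifiability means that M is
   invertible, and the criterion equals M_00 / det M.  Let x |-> (1, h(x)) be
   the affine change of the regression function, with matrix T, that takes the
   information matrix of the claimed optimum to diag(m, 1, .., 1).  For a design
   with information matrix M', Hadamard's inequality applied to T M' T^T and the
   arithmetic-geometric mean inequality give
   det(T)^2 det M' <= M'_00 (s / k)^k, where s is the average over the design of
   lambda(x) |h(x)|^2 and lambda is the intensity; equality holds at the optimum.
   It remains to see lambda |h|^2 <= k on the design region.  In the coordinates
   y_i = beta_i (d_i - x_i) >= 0 the left side depends only on \sum y_i and on
   \sum y_i^2, which is at most (\sum y_i)^2, and the bound becomes the statement
   that exp lies above the quadratic which interpolates it at -z and, to first
   order, at 0. *)

(** * Hadamard's inequality for Gram matrices *)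

(* Gram-Schmidt: project the other rows orthogonally to the first one. *)
Lemma hadamard_gram {F : realFieldType} {n l : nat} (B : 'M[F]_(n, l)) :
  0 <= \det (B *m B^T) <= \prod_i \sum_j B i j ^+ 2.
Proof.
elim: n B => [|n IHn] B; first by rewrite det_mx00 big_ord0 ler01 lexx.
rewrite -[n.+1]/(1 + n)%N in B *; rewrite -[B]vsubmxK.
set b := usubmx _; set C := dsubmx _.
have bbE : (b *m b^T) = (\sum_j b 0 j ^+ 2)%:M.
  apply/matrixP => i j; rewrite !ord1 !mxE mulr1n.
  by apply: eq_bigr => h _; rewrite !mxE expr2.
set s := \sum_j b 0 j ^+ 2 in bbE.
have s0 : 0 <= s by apply: sumr_ge0 => j _; exact: sqr_ge0.
have -> : \prod_i \sum_j col_mx b C i j ^+ 2 = s * \prod_i \sum_j C i j ^+ 2.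
  rewrite (@big_split_ord _ _ _ 1 n) big_ord1; congr (_ * _).
    by apply: eq_bigr => j _; rewrite col_mxEu.
  by apply: eq_bigr => i _; apply: eq_bigr => j _; rewrite col_mxEd.
have [s_eq0|s_neq0] := eqVneq s 0.
  have b0 : b = 0.
    apply/rowP => j; rewrite [RHS]mxE; apply/eqP; rewrite -sqrf_eq0; apply/eqP.
    apply: (@psumr_eq0P F _ xpredT (fun h => b 0 h ^+ 2)) => // h _.
    exact: sqr_ge0.
  by rewrite b0 tr_col_mx mul_col_row !mul0mx det_lblock det0 s_eq0 !mul0r lexx.
pose c := s^-1 *: (C *m b^T); pose P := C - c *m b.
have Pb : P *m b^T = 0.
  by rewrite mulmxBl -mulmxA bbE mul_mx_scalar scalerA mulfV// scale1r subrr.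
have -> : col_mx b C = block_mx (1%:M : 'M[F]_1) 0 c 1%:M *m col_mx b P.
  by rewrite mul_block_col !mul1mx mul0mx addr0 addrC subrK.
rewrite trmx_mul mulmxA -(mulmxA _ (col_mx b P)) tr_col_mx mul_col_row Pb.
have -> : b *m P^T = 0 by apply: trmx_inj; rewrite trmx_mul trmxK trmx0.
rewrite !det_mulmx det_tr !det_lblock !det1 bbE det_scalar1 !mul1r mulr1.
have /andP[detP leP] := IHn P; rewrite mulr_ge0//=.
apply: ler_wpM2l => //; apply: (le_trans leP).
apply: ler_prod => i _; apply/andP; split.
  by apply: sumr_ge0 => j _; exact: sqr_ge0.
(* Since [P] is orthogonal to [b], the squared norms of row [i] of [C] and of [P] differ by
   [c i 0 ^+ 2 * s]. *)
rewrite -subr_ge0 -sumrB.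
have : (P *m b^T) i 0 = 0 by rewrite Pb mxE.
rewrite mxE => Pbi.
have -> : \sum_j (C i j ^+ 2 - P i j ^+ 2) =
    \sum_j (2 * c i 0 * (P i j * b^T j 0) + c i 0 ^+ 2 * b 0 j ^+ 2).
  apply: eq_bigr => j _.
  have -> : C i j = P i j + c i 0 * b 0 j.
    by rewrite -[C in LHS](subrK (c *m b)) mxE [(c *m b) i j]mxE big_ord1.
  by rewrite [b^T j 0]mxE; ring.
by rewrite big_split /= -!mulr_sumr Pbi mulr0 add0r mulr_ge0 ?sqr_ge0.
Qed.

(** * The criterion and a sufficient condition for optimality *)

(* [M *m row_mx e_0 H] is block triangular with determinant [M 0 0]. *)
Lemma det_slope_cov {R : realType} {k : nat} (M G : 'M[R]_(1 + k)) :
  M 0 0 != 0 -> identifiable M -> ginv M G ->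
  \det M != 0 /\ \det ((Amx R k)^T *m G *m Amx R k) = M 0 0 / \det M.
Proof.
move=> M00 [H AH] MG.
pose N : 'M[R]_(1 + k) := row_mx (delta_mx 0 0) H.
have MN : M *m N = block_mx (M 0 0)%:M 0 (dlsubmx M) 1%:M.
  rewrite mul_mx_row -AH /Amx tr_row_mx trmx0 trmx1.
  rewrite block_mxEh; congr row_mx; apply/colP => i.
  rewrite -colE mxE; case: (split_ordP i) => j ->.
    rewrite col_mxEu [j]ord1 mxE eqxx mulr1n; congr (M _ _); exact: val_inj.
  by rewrite col_mxEd !mxE; congr (M _ _); exact: val_inj.
have dMN : \det M * \det N = M 0 0.
  by rewrite -det_mulmx MN det_lblock det_scalar1 det1 mulr1.
have dM : \det M != 0.
  by apply: contra_neq M00 => dM0; rewrite -dMN dM0 mul0r.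
split=> //.
have uM : M \in unitmx by rewrite unitmxE unitfE.
have -> : (Amx R k)^T *m G *m Amx R k = dsubmx H.
  have GM : G *m M = 1%:M.
    by move: MG; rewrite /ginv -mulmxA => /(canRL (mulKmx uM)); rewrite mulVmx.
  rewrite -mulmxA {2}AH (mulmxA G) GM mul1mx /Amx trmxK.
  by rewrite -{1}[H]vsubmxK mul_row_col mul0mx mul1mx add0r.
have -> : \det (dsubmx H) = \det N.
  have -> : N = block_mx 1%:M (usubmx H) 0 (dsubmx H).
    rewrite /N -[H in LHS]vsubmxK block_mxEh; congr row_mx; apply/colP => i.
    by case: (split_ordP i) => j ->; rewrite ?col_mxEu ?col_mxEd ?ord1 !mxE.
  by rewrite det_ublock det1 mul1r.
by rewrite -dMN mulrAC mulfV// mul1r.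
Qed.

Lemma mulmx_info_mx {R : realType} {k l : nat} (X : 'I_l -> 'cV[R]_k)
    (w : 'I_l -> R) (beta : 'cV[R]_(1 + k)) (T : 'M[R]_(1 + k)) :
  let om j := w j * expR (((freg (X j))^T *m beta) 0 0) in
  T *m info_mx X w beta *m T^T =
    \matrix_(r, s) \sum_j
      om j * ((T *m freg (X j)) r 0 * (T *m freg (X j)) s 0).
Proof.
move=> om; apply/matrixP => r s.
rewrite /info_mx mulmx_sumr mulmx_suml summxE mxE; apply: eq_bigr => j _.
rewrite -scalemxAr -scalemxAl mxE mulmxA -(mulmxA (T *m freg (X j))).
rewrite -trmx_mul [(_ *m _^T) r s]mxE big_ord1.
by rewrite [(_ *m _)^T _ _]mxE.
Qed.

(** This entry is the sum of the weights times intensities; it could vanish only with all the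
    weights, which sum to 1. *)
Lemma info_mx00_gt0 {R : realType} {k l : nat} (u v : 'cV[R]_k)
    (X : 'I_l -> 'cV[R]_k) (w : 'I_l -> R) (beta : 'cV[R]_(1 + k)) :
  is_design u v X w -> 0 < info_mx X w beta 0 0.
Proof.
move=> [w0 w1 _].
have -> : info_mx X w beta 0 0 =
    \sum_j w j * expR (((freg (X j))^T *m beta) 0 0).
  rewrite /info_mx summxE; apply: eq_bigr => j _.
  have f0 : freg (X j) 0 0 = 1.
    by rewrite /freg mxE; case: splitP => // i _; rewrite mxE.
  by rewrite mxE [(_ *m _^T) 0 0]mxE big_ord1 [_^T 0 0]mxE f0 !mulr1.
have om0 j : 0 <= w j * expR (((freg (X j))^T *m beta) 0 0).
  by rewrite mulr_ge0 ?expR_ge0.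
rewrite lt_neqAle sumr_ge0 ?andbT//.
apply: contra_eq_neq w1 => /esym om_eq0.
rewrite big1 ?(eq_sym 0) ?oner_neq0// => j _.
have /eqP := psumr_eq0P (fun i _ => om0 i) om_eq0 (i := j) isT.
by rewrite mulf_eq0 expR_eq0 orbF => /eqP.
Qed.

Lemma standardized_intercept {R : realType} {k : nat} (T : 'M[R]_(1 + k))
    (x : 'cV[R]_k) :
  usubmx T = row_mx 1%:M 0 -> (T *m freg x) (lshift k 0) 0 = 1.
Proof.
move=> T0.
rewrite -[T]vsubmxK T0 mul_col_mx col_mxEu mul_row_col mul1mx mul0mx addr0.
by rewrite mxE.
Qed.

(** The sufficiency half of an equivalence theorem: with M the information matrix of the candidate
    and f = [freg x], the sum of squares is f^T M^-1 f - 1/m. *)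
Lemma Ds_optimal_sufficient {R : realType} {k l : nat} (u v : 'cV[R]_k)
    (beta : 'cV[R]_(1 + k)) (X : 'I_l -> 'cV[R]_k) (w : 'I_l -> R)
    (T : 'M[R]_(1 + k)) (m : R) :
  (0 < k)%N -> is_design u v X w ->
  usubmx T = row_mx 1%:M 0 ->
  T *m info_mx X w beta *m T^T = block_mx m%:M 0 0 1%:M ->
  (forall x : 'cV[R]_k, (forall i, u i 0 <= x i 0 <= v i 0) ->
     expR (((freg x)^T *m beta) 0 0) *
       \sum_i (T *m freg x) (rshift 1 i) 0 ^+ 2 <= k%:R) ->
  Ds_optimal u v beta X w.
Proof.
move=> k0 dX T0 TM sens.
have l00 : lshift k 0 = 0 :> 'I_(1 + k) by exact: val_inj.
(* The first row of [T] is that of the identity, so the congruence keeps the top left entry. *)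
have TMT00 (l' : nat) (X' : 'I_l' -> 'cV[R]_k) w' :
    (T *m info_mx X' w' beta *m T^T) 0 0 = info_mx X' w' beta 0 0.
  have infoE : info_mx X' w' beta = 1%:M *m info_mx X' w' beta *m 1%:M^T.
    by rewrite trmx1 mul1mx mulmx1.
  rewrite [in RHS]infoE !mulmx_info_mx [LHS]mxE [RHS]mxE.
  apply: eq_bigr => j _; rewrite -l00 standardized_intercept// mul1mx.
  by have -> : freg (X' j) (lshift k 0) 0 = 1 by rewrite col_mxEu mxE.
have mE : m = info_mx X w beta 0 0.
  by rewrite -TMT00 TM -l00 block_mxEul mxE eqxx mulr1n.
have m0 : 0 < m by rewrite mE; exact: info_mx00_gt0 dX.
have dTM : \det T ^+ 2 * \det (info_mx X w beta) = m.
  have : \det (T *m info_mx X w beta *m T^T) = m.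
    by rewrite TM det_lblock det_scalar1 det1 mulr1.
  by rewrite !det_mulmx det_tr => <-; ring.
have dM0 : \det (info_mx X w beta) != 0.
  by apply: contraTneq m0 => d0; rewrite -dTM d0 mulr0 ltxx.
have idM : identifiable (info_mx X w beta).
  exists (invmx (info_mx X w beta) *m Amx R k).
  by rewrite mulKVmx// unitmxE unitfE.
split=> // l' X' w' dX' idM' G G' gG gG'.
have m'0 := info_mx00_gt0 _ _ _ _ beta dX'.
have [|_ ->] := det_slope_cov _ _ _ idM gG; first by rewrite -mE gt_eqF.
have [|dM'0 ->] := det_slope_cov _ _ _ idM' gG'; first by rewrite gt_eqF.
(* The candidate has criterion value [\det T ^+ 2]. *)
rewrite -mE -dTM mulfK//.
case: dX' => w'0 w'1 X'uv.
pose om j := w' j * expR (((freg (X' j))^T *m beta) 0 0).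
have om0 j : 0 <= om j by rewrite mulr_ge0 ?expR_ge0.
pose B : 'M[R]_(1 + k, l') :=
  \matrix_(r, j) (Num.sqrt (om j) * (T *m freg (X' j)) r 0).
have BE : T *m info_mx X' w' beta *m T^T = B *m B^T.
  rewrite mulmx_info_mx; apply/matrixP => r s; rewrite !mxE.
  apply: eq_bigr => j _; rewrite [B r j]mxE [B^T j s]mxE [B s j]mxE.
  by rewrite -[LHS]/(om j * _) -[in LHS](sqr_sqrtr (om0 j)); ring.
have B2 r j : B r j ^+ 2 = om j * (T *m freg (X' j)) r 0 ^+ 2.
  by rewrite mxE exprMn sqr_sqrtr.
have /andP[dB0 dB] := hadamard_gram B.
have dTM' : \det T ^+ 2 * \det (info_mx X' w' beta) = \det (B *m B^T).
  by rewrite -BE !det_mulmx det_tr; ring.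
(* Nonnegative because the Gram determinant is, nonzero by identifiability. *)
have dM'_gt0 : 0 < \det (info_mx X' w' beta).
  have T20 : 0 < \det T ^+ 2.
    rewrite exprn_even_gt0//=; apply: contraTneq m0 => d0.
    by rewrite -dTM d0 expr0n mul0r ltxx.
  by rewrite lt_neqAle eq_sym dM'0 -(pmulr_rge0 _ T20) dTM'.
rewrite ler_pdivlMr// dTM' (le_trans dB)//.
rewrite big_split_ord big_ord1 -[leRHS]mulr1; apply: ler_pM.
- by apply: sumr_ge0 => j _; exact: sqr_ge0.
- by apply: prodr_ge0 => i _; apply: sumr_ge0 => j _; exact: sqr_ge0.
- rewrite -TMT00 BE l00 [leRHS]mxE; apply: ler_sum => j _.
  by rewrite [B^T _ _]mxE expr2.
(* By [sens], averaged with the weights [w'], these squared row norms have mean at most 1, hence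
   product at most 1. *)
pose N i := \sum_j B (rshift 1 i) j ^+ 2.
have N0 i : 0 <= N i by apply: sumr_ge0 => j _; exact: sqr_ge0.
have [AGM _] := @leif_AGM R 'I_k predT N (fun i _ => N0 i).
apply: (le_trans AGM); rewrite card_ord exprn_ile1//.
  by rewrite divr_ge0// sumr_ge0.
rewrite ler_pdivrMr ?ltr0n// mul1r exchange_big /=.
rewrite -[leRHS]mul1r -[X in X * _]w'1 mulr_suml; apply: ler_sum => j _.
under eq_bigr do rewrite B2.
by rewrite -mulr_sumr -mulrA; apply: ler_wpM2l => //; apply: sens.
Qed.

(** * Inequalities for the exponential *)

Lemma derive_ge0_le {R : realType} (f df : R -> R) (a b : R) : a <= b ->
  (forall x, a <= x <= b -> is_derive x 1 f (df x)) ->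
  (forall x, a <= x <= b -> 0 <= df x) -> f a <= f b.
Proof.
move=> ab fdf df0.
have fdf' x : x \in `]a, b[ -> is_derive x 1 f (df x).
  by rewrite in_itv => /andP[/ltW ax /ltW xb]; apply: fdf; rewrite ax.
have fc : {within `[a, b], continuous f}.
  by apply: derivable_within_continuous => x; rewrite in_itv => /fdf[].
have [c] := MVT_segment ab fdf' fc.
by rewrite in_itv/= => /df0 dfc fba; rewrite -subr_ge0 fba mulr_ge0// subr_ge0.
Qed.

Lemma expR_ge_taylor2 {R : realType} (t : R) :
  0 <= t -> 1 + t + t ^+ 2 / 2 <= expR t.
Proof.
move=> t0; rewrite -subr_ge0.
suff : expR 0 - (1 + 0 + 0 ^+ 2 / 2) <= expR t - (1 + t + t ^+ 2 / 2) :> R.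
  by apply: le_trans; rewrite expR0; lra.
apply: (@derive_ge0_le R (fun x => expR x - (1 + x + x ^+ 2 / 2))
  (fun x => expR x - (1 + x))) => //.
- by move=> x _; apply: is_derive_eq; rewrite /GRing.scale /=; field.
- by move=> x _; rewrite subr_ge0 expR_ge1Dx.
Qed.

Lemma expRN_le_taylor2 {R : realType} (t : R) :
  0 <= t -> expR (- t) <= 1 - t + t ^+ 2 / 2.
Proof.
move=> t0; rewrite -subr_ge0.
suff : 1 - 0 + 0 ^+ 2 / 2 - expR (- 0) <= 1 - t + t ^+ 2 / 2 - expR (- t) :> R.
  by apply: le_trans; rewrite oppr0 expR0; lra.
apply: (@derive_ge0_le R (fun x => 1 - x + x ^+ 2 / 2 - expR (- x))
  (fun x => expR (- x) - (1 - x))) => //.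
- by move=> x _; apply: is_derive_eq; rewrite /GRing.scale /=; field.
- by move=> x _; rewrite subr_ge0 expR_ge1Dx.
Qed.

(* Gives the sign of the derivative of [(expR (- t) - 1 + t) / t ^+ 2]. *)
Lemma expRN_pade {R : realType} (t : R) :
  0 <= t -> 2 - t <= (t + 2) * expR (- t).
Proof.
move=> t0; rewrite -subr_ge0.
suff : (0 + 2) * expR (- 0) - (2 - 0) <= (t + 2) * expR (- t) - (2 - t) :> R.
  by apply: le_trans; rewrite oppr0 expR0; lra.
apply: (@derive_ge0_le R (fun x => (x + 2) * expR (- x) - (2 - x))
  (fun x => 1 - (x + 1) * expR (- x))) => //.
- by move=> x _; apply: is_derive_eq; rewrite /GRing.scale /=; ring.
- move=> x _; rewrite subr_ge0 expRN ler_pdivrMr ?expR_gt0// mul1r addrC.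
  exact: expR_ge1Dx.
Qed.

(** The quotient is the divided difference of exp at the nodes 0, 0, -t, that is, the leading
    coefficient of the quadratic in [expR_ge_hermite]. *)
Lemma expRN_remainder_nonincreasing {R : realType} (t z : R) :
  0 < t -> t <= z ->
  (expR (- z) - 1 + z) / z ^+ 2 <= (expR (- t) - 1 + t) / t ^+ 2.
Proof.
move=> t0 tz; rewrite -lerN2.
apply: (@derive_ge0_le R (fun x => - ((expR (- x) - 1 + x) / x ^+ 2))
  (fun x => ((x + 2) * expR (- x) - (2 - x)) / x ^+ 3)) => //.
- move=> x /andP[tx _]; have x0 : x != 0 by rewrite gt_eqF// (lt_le_trans t0).
  have x20 : x ^+ 2 != 0 by rewrite expf_neq0.
  have D := @is_deriveV R (fun x => x ^+ 2) x _ 1 x20 _.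
  by apply: is_derive_eq; rewrite /GRing.scale /=; field.
- move=> x /andP[tx _]; have x0 : 0 <= x by rewrite (le_trans (ltW t0)).
  by rewrite divr_ge0 ?exprn_ge0// subr_ge0 expRN_pade.
Qed.

(* The quadratic interpolates expR at [- z] and, to first order, at 0. *)
Lemma expR_ge_hermite {R : realType} (z x : R) : 0 < z -> - z <= x ->
  1 + x + (expR (- z) - 1 + z) / z ^+ 2 * x ^+ 2 <= expR x.
Proof.
move=> z0 zx; have [x0|x0] := leP 0 x.
  (* The leading coefficient is at most 1/2. *)
  apply: le_trans (expR_ge_taylor2 _ x0); rewrite lerD2l mulrC.
  rewrite ler_wpM2l ?sqr_ge0// ler_pdivrMr ?exprn_gt0//.
  by have := expRN_le_taylor2 _ (ltW z0); lra.
(* For negative [x], compare with the quadratic that meets exp at [x] itself. *)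
have /(@expRN_remainder_nonincreasing R (- x) z) : 0 < - x by lra.
have x20 : 0 < x ^+ 2 by rewrite exprn_even_gt0//= lt_eqF.
by move=> /(_ ltac:(lra)); rewrite opprK sqrrN ler_pdivlMr//; lra.
Qed.

(** * The weight of the vertex and the equation for z *)

(** For z > 0 this is the positive root of the quadratic in [wstar_quadratic], with the square root
    moved to the denominator. *)
Definition wstar {R : realType} (p z : R) : R :=
  2 / (p + Num.sqrt ((p - 2) ^+ 2 + 4 * (p - 1) * expR z)).

Section WeightOfVertex.
Context {R : realType} (p : R) (p2 : 2 <= p).
Implicit Types z : R.

Let D z : R := (p - 2) ^+ 2 + 4 * (p - 1) * expR z.

Let D_gt0 z : 0 < D z.
Proof.
rewrite /D ltr_wpDl ?sqr_ge0// mulr_gt0 ?expR_gt0//; have := p2; lra.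
Qed.

Let den_gt2 z : 2 < p + Num.sqrt (D z).
Proof. by have := D_gt0 z; rewrite -sqrtr_gt0; have := p2; lra. Qed.

Lemma wstar_gt0 z : 0 < wstar p z.
Proof. by rewrite divr_gt0// (lt_trans _ (den_gt2 z)). Qed.

Lemma wstar_lt1 z : wstar p z < 1.
Proof. by rewrite ltr_pdivrMr ?mul1r ?den_gt2// (lt_trans _ (den_gt2 z)). Qed.

(** Apart from 0 < w < 1, the optimality argument uses the closed form only through this
    equation. *)
Lemma wstar_quadratic z :
  (p - 1) * wstar p z ^+ 2 * (expR z - 1) + p * wstar p z = 1.
Proof.
have q0 : p + Num.sqrt (D z) != 0 by rewrite gt_eqF// (lt_trans _ (den_gt2 z)).
have /(congr1 (fun t => t - (p - 2) ^+ 2)) := sqr_sqrtr (ltW (D_gt0 z)).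
rewrite {2}/D addrAC subrr add0r /wstar -/(D z).
set q := Num.sqrt (D z) in q0 * => qE.
(* Exposes the term of the discriminant that [qE] expresses through the square root. *)
have -> : expR z - 1 = (4 * (p - 1) * expR z - 4 * (p - 1)) / (4 * (p - 1)).
  by field; rewrite gt_eqF//; have := p2; lra.
by rewrite -qE; field; rewrite q0 /= gt_eqF//; have := p2; lra.
Qed.

Lemma wstar_nonincreasing z z' : z <= z' -> wstar p z' <= wstar p z.
Proof.
move=> zz'; rewrite ler_pM2l// lef_pV2 ?posrE ?(lt_trans _ (den_gt2 _))//.
rewrite lerD2l ler_wsqrtr// lerD2l ler_wpM2l ?ler_expR//; have := p2; lra.
Qed.

Lemma wstar_continuous : continuous (wstar p).
Proof.
move=> z; rewrite /wstar.
apply: cvgM; first exact: cvg_cst.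
apply: cvgV; first by rewrite gt_eqF// (lt_trans _ (den_gt2 z)).
apply: cvgD; first exact: cvg_cst.
apply: continuous_cvg; first exact: sqrt_continuous.
apply: cvgD; first exact: cvg_cst.
apply: cvgM; first exact: cvg_cst.
exact: continuous_expR.
Qed.

(** The left side is strictly increasing, because the weight is below 1 and does not increase;
    existence is by intermediate values. *)
Lemma wstar_equation_unique : exists! z : R, 0 < z /\ z * (1 - wstar p z) = 2.
Proof.
have wlt1 := wstar_lt1.
pose f z := z * (1 - wstar p z).
have f_lt z z' : 0 < z -> z < z' -> f z < f z'.
  move=> z0 zz'; rewrite /f; apply: (@lt_le_trans _ _ (z' * (1 - wstar p z))).
    by rewrite ltr_pM2r// subr_gt0.
  apply: ler_wpM2l; first exact: ltW (lt_trans z0 zz').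
  by rewrite lerD2l lerN2 wstar_nonincreasing// ltW.
(* The quadratic gives p w <= 1 for z >= 0, so 1 - w >= (p - 1) / p, and this [b] makes [f b] at
   least 2. *)
pose b : R := 2 * p / (p - 1).
have b0 : 0 < b by rewrite divr_gt0 ?mulr_gt0//; have := p2; lra.
have fc : {within `[0, b], continuous f}.
  apply: continuous_subspaceT => z; apply: cvgM; first exact: cvg_id.
  by apply: cvgB; [exact: cvg_cst|exact: wstar_continuous].
have fb : 2 <= f b.
  have pw : p * wstar p b <= 1.
    rewrite -[leRHS](wstar_quadratic b) lerDr mulr_ge0//.
      by rewrite mulr_ge0 ?sqr_ge0//; have := p2; lra.
    by rewrite subr_ge0 -expR0 ler_expR ltW.
  rewrite /f /b mulrAC ler_pdivlMr; last by have := p2; lra.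
  by have := p2; nra.
have [z] : exists2 z, z \in `[0, b] & f z = 2.
  apply: IVT; first exact: ltW.
    exact: fc.
  by rewrite ge_min le_max fb orbT {1}/f mul0r ler0n.
rewrite in_itv/= => /andP[z0 zb] fz; exists z.
have z_gt0 : 0 < z.
  rewrite lt_neqAle z0 andbT; apply: contra_eq_neq fz => <-.
  by rewrite /f mul0r lt_eqF.
split=> // z' [z'0 fz'].
have [/f_lt|/f_lt|//] := ltgtP z z'; rewrite fz -/(f _).
  by move=> /(_ z_gt0); rewrite /f fz' ltxx.
by move=> /(_ z'0); rewrite /f fz' ltxx.
Qed.

End WeightOfVertex.

(** * Slack coordinates and standardization *)

Section Standardization.
Context {R : realType} {k : nat}.
Implicit Types (b d x : 'cV[R]_k) (g t c : R).

Definition slack b d x i : R := b i 0 * (d i 0 - x i 0).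

(* Maps [freg x] to [(1, g (y - c 1 + t (1^T y) 1))] with [y = slack b d x]. *)
Definition standardizer b d g t c : 'M[R]_(1 + k) :=
  block_mx 1%:M 0
    (\col_i (g * (b i 0 * d i 0 - c + t * \sum_l b l 0 * d l 0)))
    (\matrix_(i, l) (- (g * ((i == l)%:R * b l 0 + t * b l 0)))).

Lemma usubmx_standardizer b d g t c :
  usubmx (standardizer b d g t c) = row_mx 1%:M 0.
Proof. by rewrite /standardizer /block_mx col_mxKu. Qed.

Lemma standardizerE b d g t c x i :
  (standardizer b d g t c *m freg x) (rshift 1 i) 0 =
  g * (slack b d x i - c + t * \sum_l slack b d x l).
Proof.
rewrite /standardizer mul_block_col col_mxEd mxE.
rewrite [X in X + _]mxE big_ord1 !mxE mulr1.
have -> : \sum_l slack b d x l = \sum_l b l 0 * d l 0 - \sum_l b l 0 * x l 0.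
  by rewrite -sumrB; apply: eq_bigr => l _; rewrite -mulrBr.
have -> : \sum_l
    (\matrix_(i, l) - (g * ((i == l)%:R * b l 0 + t * b l 0))) i l * x l 0 =
    - g * (b i 0 * x i 0) - g * t * \sum_l b l 0 * x l 0.
  transitivity (\sum_l (- g * (b i 0 * x i 0) * (l == i)%:R -
                       g * t * (b l 0 * x l 0))).
    apply: eq_bigr => l _; rewrite mxE (eq_sym i).
    by have [->|_] := eqVneq l i; rewrite /=; ring.
  rewrite sumrB -!mulr_sumr (bigD1 i)//= eqxx big1 => [|l /negPf->//].
  by rewrite /=; ring.
by rewrite /slack; ring.
Qed.

(** The constant factor is the intensity at [d]; [x] enters only through its total slack. *)
Lemma freg_intensity (beta : 'cV[R]_(1 + k)) d x :
  let b := dsubmx beta in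
  expR (((freg x)^T *m beta) 0 0) =
  expR (beta 0 0 + \sum_i b i 0 * d i 0) * expR (- \sum_i slack b d x i).
Proof.
move=> b; rewrite -expRD; congr expR.
rewrite -[beta in LHS]vsubmxK /freg tr_col_mx mul_row_col mxE.
rewrite [X in X + _]mxE big_ord1 [X in _ + X]mxE -addrA -sumrB.
congr (_ + _).
  by rewrite !mxE mul1r; congr (beta _ _); exact: val_inj.
by apply: eq_bigr => i _; rewrite mxE /slack -/b; ring.
Qed.

End Standardization.

(** * Coordinate sums and the sensitivity bound *)

(** With [sum_delta2], evaluates the moments of the support points other than [d], whose
    standardized coordinates have this form up to the factor g. *)
Lemma sum_delta {R : realType} {k : nat} (i : 'I_k) (z e : R) :
  \sum_(j < k) (z * (j == i)%:R - e) = z - k%:R * e.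
Proof.
rewrite sumrB -mulr_sumr sumr_const card_ord mulr_natl; congr (_ - _).
by rewrite (bigD1 i)//= eqxx big1 ?addr0 ?mulr1// => j /negPf->.
Qed.

Lemma sum_delta2 {R : realType} {k : nat} (i l : 'I_k) (z e : R) :
  \sum_(j < k) (z * (j == i)%:R - e) * (z * (j == l)%:R - e) =
  z ^+ 2 * (i == l)%:R - 2 * z * e + k%:R * e ^+ 2.
Proof.
transitivity (\sum_(j < k) (z * (z * (i == l)%:R - e) * (j == i)%:R -
                           e * (z * (j == l)%:R - e))).
  by apply: eq_bigr => j _; have [->|_] := eqVneq j i; rewrite /=; ring.
rewrite sumrB -!mulr_sumr sum_delta (bigD1 i)//= eqxx big1 => [|j /negPf->//].
by rewrite /=; ring.
Qed.

(** The cross terms are nonnegative; they vanish when at most one coordinate is nonzero, as at the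
    support points of the optimum. *)
Lemma sum_sqr_le {R : realType} {k : nat} (y : 'I_k -> R) :
  (forall i, 0 <= y i) -> \sum_i y i ^+ 2 <= (\sum_i y i) ^+ 2.
Proof.
move=> y0; rewrite expr2 mulr_suml; apply: ler_sum => i _.
rewrite expr2 ler_wpM2l// (bigD1 i)//= lerDl sumr_ge0//.
Qed.

(** Here [b] is the weight of the vertex, [a] the other weight times exp(-z), and [t], [c] are the
    constants of the standardizer. The right side is k with the scale g^2 and the intensity at [d]
    divided out. *)
Lemma sensitivity_bound {R : realType} {k : nat} (y : 'I_k -> R)
    (z a b r t c q : R) :
  let K : R := k%:R in
  0 < z -> (forall i, 0 <= y i) ->
  z * (1 - b) = 2 -> K * a * z = 2 * expR (- z) -> r = K * a + b -> a = r * b ->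
  r = K * t ^+ 2 + 2 * t -> q = K * t + 1 -> q != 0 -> c * q = z * r ->
  expR (- \sum_i y i) * \sum_i (y i - c + t * \sum_l y l) ^+ 2 <=
    K * a * z ^+ 2.
Proof.
move=> K z0 y0 bz Kaz rE aE rt qE q0 cq.
set s := \sum_i y i.
have s0 : 0 <= s by apply: sumr_ge0.
rewrite expRN ler_pdivrMl ?expR_gt0//.
have -> : \sum_i (y i - c + t * s) ^+ 2 =
    \sum_i y i ^+ 2 - 2 * (c - t * s) * s + K * (c - t * s) ^+ 2.
  rewrite (eq_bigr (fun i => y i ^+ 2 - 2 * (c - t * s) * y i +
                             (c - t * s) ^+ 2)).
    rewrite big_split /= sumrB -mulr_sumr sumr_const card_ord.
    by rewrite -[_ *+ k]mulr_natl.
  by move=> i _; ring.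
(* Replacing the sum of squares by [s ^+ 2] leaves a quadratic in [s] alone. *)
apply: (@le_trans _ _ (s ^+ 2 * (1 + r) - 2 * s * r * z + K * a * z ^+ 2)).
  have -> : s ^+ 2 * (1 + r) - 2 * s * r * z + K * a * z ^+ 2 =
      s ^+ 2 - 2 * (c - t * s) * s + K * (c - t * s) ^+ 2.
    have q2 : q ^+ 2 = 1 + K * r by rewrite qE rt; ring.
    (* The constant terms agree: b q^2 = b + K a = r gives c^2 = a z^2. *)
    have Kc2 : K * c ^+ 2 = K * a * z ^+ 2.
      apply: (mulIf (expf_neq0 2 q0)).
      have -> : K * c ^+ 2 * q ^+ 2 = K * (c * q) ^+ 2 by ring.
      have -> : K * (c * q) ^+ 2 = K * z ^+ 2 * r ^+ 2 by rewrite cq; ring.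
      have -> : K * a * z ^+ 2 * q ^+ 2 = K * z ^+ 2 * (a * q ^+ 2) by ring.
      have bq : b * q ^+ 2 = r by rewrite q2 [RHS]rE aE; ring.
      by congr (_ * _); rewrite aE -mulrA bq.
    have cqs : c * (K * t + 1) * s = z * r * s by rewrite -qE cq.
    have rs2 : s ^+ 2 * r = s ^+ 2 * (K * t ^+ 2 + 2 * t) by rewrite -rt.
    by lra.
  by rewrite lerD2r lerD2r sum_sqr_le.
have zr : z * r = 2 * expR (- z) + z - 2 by rewrite rE; lra.
have sz : - z <= s - z by lra.
(* The nodes -z and 0 of [s - z] are the total slacks 0 of [d] and z of the other support points;
   the factor 2 z turns the interpolant into the quadratic above. *)
have /(ler_wpM2l (ltW z0)) /(ler_wpM2l (ler0n R 2)) :=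
  expR_ge_hermite z _ z0 sz.
have -> : 2 * (z * expR (s - z)) = expR s * (K * a * z ^+ 2).
  by rewrite expRD expr2 [K * a * _]mulrA Kaz; ring.
apply: le_trans; rewrite le_eqVlt; apply/orP; left; apply/eqP.
have -> : expR (- z) - 1 + z = z * (1 + r) / 2 by lra.
have -> : 2 * (z * (1 + (s - z) + z * (1 + r) / 2 / z ^+ 2 * (s - z) ^+ 2)) =
    2 * z * (1 + (s - z)) + (1 + r) * (s - z) ^+ 2 by field; rewrite gt_eqF.
have zKaz : K * a * z ^+ 2 = (z * r - z + 2) * z.
  by rewrite expr2 [K * a * _]mulrA Kaz; congr (_ * _); lra.
by rewrite zKaz; ring.
Qed.

(** * Moments of the candidate design *)

(* In slack coordinates the slopes of this design have covariance proportional to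
   the inverse of I + r J, with J the all-ones matrix; r = K t^2 + 2 t makes
   I + t J a square root of I + r J, and c centers the standardized points. *)
Lemma standardized_info_mx {R : realType} {k : nat} (beta : 'cV[R]_(1 + k))
    (d : 'cV[R]_k) (z w1 wp r t c q g : R) :
  let K : R := k%:R in
  let b := dsubmx beta in
  let Lam := expR (beta 0 0 + \sum_i b i 0 * d i 0) in
  let a := w1 * expR (- z) in
  let T := standardizer b d g t c in
  (forall i, b i 0 != 0) -> a = r * wp -> r = K * t ^+ 2 + 2 * t ->
  q = K * t + 1 -> q != 0 -> c * q = z * r -> g ^+ 2 * (Lam * a) * z ^+ 2 = 1 ->
  T *m info_mx
    (fun j : 'I_k.+1 =>
       \col_i (d i 0 - (if (j == i :> nat) then z / b i 0 else 0)))
    (fun j : 'I_k.+1 => if (j < k)%N then w1 else wp) beta *m T^T =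
  block_mx (Lam * (K * a + wp))%:M 0 0 1%:M.
Proof.
move=> K b Lam a T b0 aE rE qE q0 cq gE.
set X := fun j : 'I_k.+1 => \col_i _.
have slackX (j : 'I_k.+1) i : slack b d (X j) i = z * (j == i :> nat)%:R.
  rewrite /slack [X j i 0]mxE.
  case: eqP => _; last by rewrite subr0 subrr !mulr0.
  by rewrite opprB addrC subrK mulrC divfK// mulr1.
have sum1 (j : 'I_k) : \sum_l slack b d (X (widen_ord (leqnSn k) j)) l = z.
  under eq_bigr do rewrite slackX /=.
  rewrite -mulr_sumr (bigD1 j)//= eqxx big1 ?addr0 ?mulr1// => l.
  by rewrite eq_sym -val_eqE => /negPf/= ->.
(* The last index has value k, which matches no coordinate, so this point is [d]. *)
have sum0 : \sum_l slack b d (X ord_max) l = 0.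
  by rewrite big1 // => l _; rewrite slackX /= gtn_eqF ?mulr0.
pose e := c - t * z.
have h1 (j i : 'I_k) : (T *m freg (X (widen_ord (leqnSn k) j))) (rshift 1 i) 0 =
    g * (z * (j == i)%:R - e).
  by rewrite standardizerE sum1 slackX /= val_eqE /e; ring.
have h0 (i : 'I_k) : (T *m freg (X ord_max)) (rshift 1 i) 0 = g * (- c).
  by rewrite standardizerE sum0 slackX /= gtn_eqF// mulr0; ring.
have f0 x : (T *m freg x) (lshift k 0) 0 = 1.
  exact/standardized_intercept/usubmx_standardizer.
(* Multiplied by powers of [q], the moments involve [c] and [e] only through [c * q] and [e * q],
   which are free of division. *)
have eqE : e * q = z * t by rewrite /e mulrBl cq rE qE; ring.
have moment1 (i : 'I_k) :
    \sum_(j < k) (Lam * a) * (g * (z * (j == i)%:R - e)) +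
      Lam * wp * (g * - c) = 0.
  rewrite -2!mulr_sumr sum_delta; apply: (mulIf q0); rewrite mul0r.
  have -> : (Lam * a * (g * (z - K * e)) + Lam * wp * (g * - c)) * q =
     Lam * g * (a * (z * q - K * (e * q)) - wp * (c * q)) by ring.
  by rewrite eqE cq aE qE; ring.
have moment2 (i l : 'I_k) :
    \sum_(j < k) (Lam * a) *
        ((g * (z * (j == i)%:R - e)) * (g * (z * (j == l)%:R - e))) +
      Lam * wp * ((g * - c) * (g * - c)) = (i == l)%:R.
  rewrite (eq_bigr (fun j => (Lam * a * g ^+ 2) *
    ((z * (j == i)%:R - e) * (z * (j == l)%:R - e)))); last by move=> j _; ring.
  rewrite -mulr_sumr sum_delta2; apply: (mulIf (expf_neq0 2 q0)).
  have -> : (Lam * a * g ^+ 2 *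
        (z ^+ 2 * (i == l)%:R - 2 * z * e + k%:R * e ^+ 2) +
      Lam * wp * (g * - c * (g * - c))) * q ^+ 2 =
    g ^+ 2 * (Lam * a) * z ^+ 2 * ((i == l)%:R * q ^+ 2) + Lam * g ^+ 2 *
       (a * (K * (e * q) ^+ 2 - 2 * z * q * (e * q)) + wp * (c * q) ^+ 2).
    by rewrite /K; ring.
  rewrite gE eqE cq mul1r aE qE.
  have -> : r * wp * (K * (z * t) ^+ 2 - 2 * z * (K * t + 1) * (z * t)) +
     wp * (z * r) ^+ 2 = z ^+ 2 * r * wp * (r - (K * t ^+ 2 + 2 * t)) by ring.
  by rewrite -rE subrr !mulr0 addr0.
have om1 (j : 'I_k) :
    w1 * expR (((freg (X (widen_ord (leqnSn k) j)))^T *m beta) 0 0) = Lam * a.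
  by rewrite (freg_intensity _ d) -/b -/Lam sum1 /a; ring.
have om0 : wp * expR (((freg (X ord_max))^T *m beta) 0 0) = Lam * wp.
  by rewrite (freg_intensity _ d) -/b -/Lam sum0 oppr0 expR0; ring.
rewrite mulmx_info_mx; apply/matrixP => i l; rewrite [LHS]mxE big_ord_recr /=.
rewrite ltnn om0; under eq_bigr do rewrite ltn_ord om1.
case: (split_ordP i) => i' ->; case: (split_ordP l) => l' ->.
- rewrite !ord1 block_mxEul !f0 [RHS]mxE eqxx mulr1n.
  under eq_bigr do rewrite !f0.
  by rewrite sumr_const card_ord -mulr_natl !mulr1 /K; ring.
- rewrite ord1 block_mxEur f0 h0 [RHS]mxE -[RHS](moment1 l') mul1r.
  by under eq_bigr do rewrite f0 h1 mul1r.
- rewrite ord1 block_mxEdl f0 h0 [RHS]mxE -[RHS](moment1 i') mulr1.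
  by under eq_bigr do rewrite f0 h1 mulr1.
- rewrite block_mxEdr !h0 [RHS]mxE -[RHS]moment2.
  by under eq_bigr do rewrite !h1.
Qed.

(** * Choice of the constants and conclusion *)

(* k = p - 1 >= 1; beta = (beta_0, beta_1..beta_k), dsubmx beta i 0 = beta_{i+1}. *)
Theorem theorem9 (R : realType) (k : nat) (hk : (0 < k)%N)
  (u v : 'cV[R]_k) (huv : forall i, u i 0 < v i 0)
  (beta : 'cV[R]_(1 + k)) (hb : forall i, dsubmx beta i 0 != 0) :
  let p : R := (k.+1)%:R in
  let wp := fun z : R =>
    2 / (p + Num.sqrt ((p - 2) ^+ 2 + 4 * (p - 1) * expR z)) in
  let w1 := fun z : R => (1 - wp z) / (p - 1) in
  let d : 'cV[R]_k :=
    \col_i (if 0 < dsubmx beta i 0 then v i 0 else u i 0) in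
  (exists! z : R, 0 < z /\ z * (1 - wp z) = 2) /\
  (forall z : R, 0 < z -> z * (1 - wp z) = 2 ->
     (forall i, z <= `|dsubmx beta i 0| * (v i 0 - u i 0)) ->
     Ds_optimal u v beta
       (fun j : 'I_k.+1 =>
          \col_i (d i 0 - (if (j == i :> nat) then z / dsubmx beta i 0 else 0)))
       (fun j : 'I_k.+1 => if (j < k)%N then w1 z else wp z)).
Proof.
move=> p wp w1 d.
have p2 : 2 <= p by rewrite ler_nat ltnS.
have pK : p - 1 = k%:R by rewrite /p -natr1 addrK.
split; first exact: wstar_equation_unique p2.
move=> z z0 bz zle.
set K : R := k%:R in pK *.
have K0 : 0 < K by rewrite ltr0n.
have wp0 : 0 < wp z := wstar_gt0 p p2 z.
have wp1 : wp z < 1 := wstar_lt1 p p2 z.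
have wpq : (p - 1) * wp z ^+ 2 * (expR z - 1) + p * wp z = 1 :=
  wstar_quadratic p p2 z.
have w1E : w1 z = (1 - wp z) / K by rewrite /w1 pK.
have w10 : 0 < w1 z by rewrite w1E divr_gt0 ?subr_gt0.
have Kw1 : K * w1 z = 1 - wp z by rewrite w1E mulrC divfK ?gt_eqF.
set b := wp z in wp0 wp1 wpq bz w1E Kw1 *.
pose a := w1 z * expR (- z).
have a0 : 0 < a by rewrite mulr_gt0 ?expR_gt0.
pose r := K * a + b.
have Ee : expR (- z) * expR z = 1 by rewrite mulrC expRxMexpNx_1.
(* This is the quadratic for the vertex weight, after multiplication by K exp(z). *)
have aE : a = r * b.
  have Ka : K * a = (1 - b) * expR (- z) by rewrite /a mulrA Kw1.
  apply: (mulfI (lt0r_neq0 K0)); apply: (mulIf (lt0r_neq0 (expR_gt0 z))).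
  have -> : K * (r * b) * expR z = (K * a * expR z + b * expR z) * K * b.
    by rewrite /r; ring.
  rewrite Ka -(mulrA (1 - b)) Ee mulr1.
  have pE : p = K + 1 by lra.
  by move: wpq; rewrite pK pE; lra.
have r0 : 0 < r := addr_gt0 (mulr_gt0 K0 a0) wp0.
have Kr0 : 0 < 1 + K * r := addr_gt0 ltr01 (mulr_gt0 K0 r0).
have Kaz : K * a * z = 2 * expR (- z).
  by rewrite /a mulrA Kw1 -bz; ring.
(* Solves K t^2 + 2 t = r for t by completing the square. *)
pose q := Num.sqrt (1 + K * r).
have q2 : q ^+ 2 = 1 + K * r by rewrite sqr_sqrtr// ltW.
have q0 : q != 0 by rewrite gt_eqF// sqrtr_gt0.
pose t := (q - 1) / K.
have qE : q = K * t + 1 by rewrite /t mulrC divfK ?gt_eqF// subrK.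
have rE : r = K * t ^+ 2 + 2 * t.
  apply: (mulfI (lt0r_neq0 K0)).
  have -> : K * r = q ^+ 2 - 1 by rewrite q2; ring.
  by rewrite qE; ring.
pose c := z * r / q.
have cq : c * q = z * r by rewrite divfK.
pose Lam := expR (beta 0 0 + \sum_i dsubmx beta i 0 * d i 0).
have Lam0 : 0 < Lam by exact: expR_gt0.
(* Scales the standardized second moments to 1. *)
pose g := (Num.sqrt (Lam * a))^-1 / z.
have gE : g ^+ 2 * (Lam * a) * z ^+ 2 = 1.
  have La0 : 0 < Lam * a := mulr_gt0 Lam0 a0.
  rewrite /g expr_div_n exprVn sqr_sqrtr ?(ltW La0)//.
  by field; rewrite !gt_eqF.
have slack0 (x : 'cV[R]_k) : (forall i, u i 0 <= x i 0 <= v i 0) ->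
    forall i, 0 <= slack (dsubmx beta) d x i.
  move=> xuv i; rewrite /slack [d i 0]mxE; have /andP[ux xv] := xuv i.
  case: ltP => bi.
    by apply: mulr_ge0; [exact: ltW|rewrite subr_ge0].
  by apply: mulr_le0 => //; rewrite subr_le0.
apply: (@Ds_optimal_sufficient _ _ _ _ _ _ _ _
          (standardizer (dsubmx beta) d g t c) (Lam * r)) => //.
- split=> [j | | j i].
  + by case: ifP => _; exact: ltW.
  + rewrite big_ord_recr /= ltnn; under eq_bigr do rewrite ltn_ord.
    by rewrite sumr_const card_ord -mulr_natl -/K Kw1 subrK.
  (* The shift from [d i 0] has length z / |beta_i| and points to the opposite endpoint; [zle] keeps
     it inside. *)
  + rewrite mxE [d i 0]mxE; have uvi := ltW (huv i); have zi := zle i.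
    case: eqP => _; last by case: ifP => _; rewrite subr0 uvi lexx.
    case: ltP zi => bi; first rewrite gtr0_norm// => zi.
      have zb : z / dsubmx beta i 0 <= v i 0 - u i 0.
        by rewrite ler_pdivrMr// mulrC.
      by have : 0 < z / dsubmx beta i 0 := divr_gt0 z0 bi; lra.
    have {}bi : dsubmx beta i 0 < 0 by rewrite lt_neqAle hb.
    rewrite ltr0_norm// => zi.
    have zb : - (z / dsubmx beta i 0) <= v i 0 - u i 0.
      by rewrite -mulrN -invrN ler_pdivrMr ?oppr_gt0// mulrC.
    have : 0 < - (z / dsubmx beta i 0).
      by rewrite -mulrN -invrN divr_gt0 ?oppr_gt0.
    lra.
- exact: usubmx_standardizer.
- exact: standardized_info_mx aE rE qE q0 cq gE.
move=> x /slack0 y0; rewrite (freg_intensity _ d) -/Lam.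
have bound :=
  sensitivity_bound _ _ _ _ _ _ _ _ z0 y0 bz Kaz erefl aE rE qE q0 cq.
rewrite [X in _ * X](_ : _ = g ^+ 2 * \sum_i (slack (dsubmx beta) d x i - c +
    t * \sum_l slack (dsubmx beta) d x l) ^+ 2); last first.
  by rewrite mulr_sumr; apply: eq_bigr => i _; rewrite standardizerE exprMn.
(* By the choice of [g], both sides now share the factors g^2 and [Lam]. *)
have -> : k%:R = g ^+ 2 * (Lam * (K * a * z ^+ 2)).
  transitivity (K * (g ^+ 2 * (Lam * a) * z ^+ 2)); first by rewrite gE mulr1.
  by ring.
rewrite mulrCA; apply: ler_wpM2l; first exact: sqr_ge0.
rewrite -(mulrA Lam); apply: ler_wpM2l; first exact: ltW.
exact: bound.
Qed.
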